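(* Let $\Gamma=\langle\mathcal{A},\mathcal{R}\rangle$ be an AFRA which is an AF, i.e. $\mathcal{R}\subseteq\mathcal{A}\times\mathcal{A}$, and let $\mathcal{S}$ be the ideal extension of $\Gamma$. Then $\mathcal{S}=\mathcal{U}^{\rightarrow AFRA}$ where $\mathcal{U}$ is the D-ideal extension of $\Gamma$.
   Context: An AFRA (Argumentation Framework with Recursive Attacks) is a pair $\langle\mathcal{A},\mathcal{R}\rangle$ where $\mathcal{A}$ is a set (of arguments) and $\mathcal{R}$ is a set of attacks, each attack being a pair $\alpha=(A,X)$ with $A\in\mathcal{A}$ and ($X\in\mathcal{R}$ or $X\in\mathcal{A}$); $A=src(\alpha)$ is its source and $X=trg(\alpha)$ its target. Arguments and attacks are distinct objects ($\mathcal{A}\cap\mathcal{R}=\emptyset$). Defeat: for $\alpha\in\mathcal{R}$, $V\in\mathcal{A}\cup\mathcal{R}$, $\alpha$ directly defeats $V$ iff $V=trg(\alpha)$; $\alpha$ indirectly defeats $\beta\in\mathcal{R}$ iff $\alpha$ directly defeats $src(\beta)$; $\alpha\rightarrow_R V$ ($\alpha$ defeats $V$) iff $\alpha$ directly or indirectly defeats $V$. Only attacks can defeat. A set $\mathcal{S}\subseteq\mathcal{A}\cup\mathcal{R}$ is conflict-free iff there are no $V,W\in\mathcal{S}$ with $V\rightarrow_R W$. $W\in\mathcal{A}\cup\mathcal{R}$ is acceptable w.r.t. $\mathcal{S}$ iff for every $\alpha\in\mathcal{R}$ with $\alpha\rightarrow_R W$ there is $\beta\in\mathcal{S}$ with $\beta\rightarrow_R\alpha$.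 $\mathcal{S}$ is admissible iff it is conflict-free and each of its elements is acceptable w.r.t. $\mathcal{S}$. A preferred extension is a maximal (w.r.t. set inclusion) admissible set. $\mathcal{S}$ is ideal iff it is admissible and contained in every preferred extension; the ideal extension is the maximal (w.r.t. set inclusion) ideal set. Dung notions (for $\Gamma$ viewed as a Dung argumentation framework with set of arguments $\mathcal{A}$ and attack relation $\mathcal{R}\subseteq\mathcal{A}\times\mathcal{A}$): $\mathcal{U}\subseteq\mathcal{A}$ is D-conflict-free if there are no $A,B\in\mathcal{U}$ with $(A,B)\in\mathcal{R}$; $A\in\mathcal{A}$ is D-acceptable w.r.t. $\mathcal{U}$ if for all $B\in\mathcal{A}$ with $(B,A)\in\mathcal{R}$ there is $C\in\mathcal{U}$ with $(C,B)\in\mathcal{R}$; $\mathcal{U}$ is D-admissible if it is D-conflict-free and each of its elements is D-acceptable w.r.t. $\mathcal{U}$; a D-preferred extension is a maximal (w.r.t. set inclusion) D-admissible set; $\mathcal{U}$ is D-ideal if it is D-admissible and contained in every D-preferred extension; the D-ideal extension is the maximal (w.r.t. set inclusion) D-ideal set. For $\mathcal{U}\subseteq\mathcal{A}$, $\mathcal{U}^{\rightarrow AFRA}:=\mathcal{U}\cup\{\alpha\in\mathcal{R}\mid src(\alpha)\in\mathcal{U}\}$. *)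

(* Defs.v *)
From mathcomp Require Import all_boot.
From mathcomp Require Import classical_sets.

Set Implicit Arguments.
Unset Strict Implicit.
Unset Printing Implicit Defensive.

Local Open Scope classical_set_scope.

(* The set of arguments is the type A itself.  An attack is literally a pair
   (source, target), where the target is an argument or again an attack.  The
   two constructors keep arguments and attacks disjoint. *)
Inductive object (A : Type) : Type :=
| Arg of A
| Att of A * object A.

Definition attack (A : Type) : Type := (A * object A)%type.

Definition src (A : Type) (alpha : attack A) : A := alpha.1.
Definition trg (A : Type) (alpha : attack A) : object A := alpha.2.

(* The closure condition says that every target lies in the arguments or in the
   attacks. *)
Record AFRA (A : Type) := MkAFRA {
  attacks : set (attack A);
  attacks_closed : forall alpha beta : attack A,
    attacks alpha -> trg alpha = Att beta -> attacks beta
}.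

Definition maximal_for (T : Type) (P : set T -> Prop) (X : set T) : Prop :=
  P X /\ forall Y : set T, P Y -> X `<=` Y -> Y = X.

Section Semantics.
Variables (A : Type) (G : AFRA A).

Definition elements : set (object A) :=
  [set Arg a | a in [set: A]] `|` [set Att alpha | alpha in attacks G].

Definition directly_defeats (alpha : attack A) (V : object A) : Prop :=
  V = trg alpha.

Definition indirectly_defeats (alpha beta : attack A) : Prop :=
  directly_defeats alpha (Arg (src beta)).

Definition attack_defeats (alpha : attack A) (V : object A) : Prop :=
  directly_defeats alpha V \/
  exists beta, [/\ attacks G beta, V = Att beta & indirectly_defeats alpha beta].

Definition defeats (V W : object A) : Prop :=
  exists alpha, [/\ attacks G alpha, V = Att alpha & attack_defeats alpha W].

Definition conflict_free (S : set (object A)) : Prop :=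
  ~ exists V W, [/\ S V, S W & defeats V W].

Definition acceptable (S : set (object A)) (W : object A) : Prop :=
  forall alpha, attacks G alpha -> defeats (Att alpha) W ->
    exists2 V, S V & defeats V (Att alpha).

Definition admissible (S : set (object A)) : Prop :=
  [/\ S `<=` elements, conflict_free S & forall W, S W -> acceptable S W].

Definition preferred_extension : set (object A) -> Prop :=
  maximal_for admissible.

Definition ideal (S : set (object A)) : Prop :=
  admissible S /\ forall P, preferred_extension P -> S `<=` P.

Definition ideal_extension : set (object A) -> Prop := maximal_for ideal.

Definition is_AF : Prop :=
  forall alpha, attacks G alpha -> exists B : A, trg alpha = Arg B.

Definition D_attacks (B C : A) : Prop := attacks G (B, Arg C).

Definition D_conflict_free (U : set A) : Prop :=
  ~ exists B C, [/\ U B, U C & D_attacks B C].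

Definition D_acceptable (U : set A) (B : A) : Prop :=
  forall C, D_attacks C B -> exists2 D, U D & D_attacks D C.

Definition D_admissible (U : set A) : Prop :=
  D_conflict_free U /\ forall B, U B -> D_acceptable U B.

Definition D_preferred_extension : set A -> Prop := maximal_for D_admissible.

Definition D_ideal (U : set A) : Prop :=
  D_admissible U /\ forall P, D_preferred_extension P -> U `<=` P.

Definition D_ideal_extension : set A -> Prop := maximal_for D_ideal.

Definition to_AFRA (U : set A) : set (object A) :=
  [set Arg a | a in U] `|`
  [set Att alpha | alpha in [set alpha | attacks G alpha /\ U (src alpha)]].

End Semantics.

(* Main.v *)
Require Import Defs.
From mathcomp Require Import all_boot.
From mathcomp Require Import classical_sets.
From Stdlib Require Import Classical.

(** Give each argument itself as owner, and each attack its source.  In an AF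
    an element is defeated exactly by the attacks on its owner, so defeat
    depends on owners only.  Hence S |-> owner @` S and U |-> to_AFRA G U
    preserve admissibility, and they form a Galois insertion, which carries
    maximal elements to maximal elements: first preferred extensions, then
    ideal extensions correspond. *)

Set Implicit Arguments.
Unset Strict Implicit.
Unset Printing Implicit Defensive.

Local Open Scope classical_set_scope.

Section GaloisInsertion.
Variables (T T' : Type) (P : set T -> Prop) (P' : set T' -> Prop).
Variables (f : set T -> set T') (g : set T' -> set T).
Hypothesis f_mono : forall X Y, X `<=` Y -> f X `<=` f Y.
Hypothesis g_mono : forall X Y, X `<=` Y -> g X `<=` g Y.
Hypothesis gK : forall Y, f (g Y) = Y.
Hypothesis f_extensive : forall X, P X -> X `<=` g (f X).
Hypothesis fP : forall X, P X -> P' (f X).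
Hypothesis gP : forall Y, P' Y -> P (g Y).

Lemma maximal_for_closed X : maximal_for P X -> g (f X) = X.
Proof. by move=> [PX maxX]; apply: maxX; [exact/gP/fP | exact: f_extensive]. Qed.

(** For [Y] above [f X], the set [g Y] lies above [X], so [g Y = X] by maximality and
    [Y = f (g Y) = f X]. *)
Lemma maximal_for_lower X : maximal_for P X -> maximal_for P' (f X).
Proof.
move=> [PX maxX]; split=> [|Y PY fXY]; first exact: fP.
rewrite -(maxX (g Y)) ?gK //; first exact: gP.
exact: subset_trans (f_extensive PX) (g_mono fXY).
Qed.

Lemma maximal_for_upper Y : maximal_for P' Y -> maximal_for P (g Y).
Proof.
move=> [PY maxY]; split=> [|X PX gYX]; first exact: gP.
have fXY : f X = Y.
  by apply: maxY; [exact: fP | rewrite -[Y]gK; exact: f_mono].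
by apply/seteqP; split=> //; rewrite -fXY; exact: f_extensive.
Qed.

End GaloisInsertion.

Definition owner (A : Type) (V : object A) : A :=
  match V with Arg a => a | Att alpha => src alpha end.

Section Correspondence.
Variables (A : Type) (G : AFRA A).

(** Turns the union of two images into one condition on the owner, so that later proofs seldom
    separate arguments from attacks. *)
Lemma to_AFRAP U V : to_AFRA G U V <-> elements G V /\ U (owner V).
Proof.
split=> [[[a Ua <-]|[alpha [Galpha Ualpha] <-]]|].
- by split=> //; left; exists a.
- by split=> //; right; exists alpha.
- by move=> [[[a _ <-]|[alpha Galpha <-]] UV];
    [left; exists a | right; exists alpha].
Qed.

Lemma to_AFRA_mono U U' : U `<=` U' -> to_AFRA G U `<=` to_AFRA G U'.
Proof. by move=> UU' V /to_AFRAP[GV UV]; apply/to_AFRAP; split=> //; exact: UU'. Qed.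

Lemma owner_to_AFRA U : @owner A @` to_AFRA G U = U.
Proof.
apply/seteqP; split=> [_ [V /to_AFRAP[_ UV] <-] // | a Ua].
by exists (Arg a) => //; left; exists a.
Qed.

Lemma sub_to_AFRA_owner S :
  S `<=` elements G -> S `<=` to_AFRA G (@owner A @` S).
Proof. by move=> SG V SV; apply/to_AFRAP; split; [exact: SG | exists V]. Qed.

(** Two D-ideal sets lie in a common D-preferred extension, so their union is conflict-free and
    again D-ideal; maximality makes both equal to it. *)
Lemma D_ideal_extension_unique U U' :
  D_ideal_extension G U -> D_ideal_extension G U' -> U = U'.
Proof.
move=> [idU maxU] [idU' maxU'].
have [P prefP] : exists P, D_preferred_extension G P.
  (* Without D-preferred extensions every D-admissible set is D-ideal, so that
     U itself would be D-preferred. *)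
  apply: NNPP => noP; apply: (noP); exists U; split; first by case: idU.
  move=> Y admY; apply: maxU; split=> // P prefP.
  by case: noP; exists P.
have idUU' : D_ideal G (U `|` U').
  split; last first.
    by move=> Q prefQ; rewrite subUset; split; [apply: idU.2 | apply: idU'.2].
  split=> [[B [C [UB UC BC]]] | B].
    have UU'P : U `|` U' `<=` P.
      by rewrite subUset; split; [apply: idU.2 | apply: idU'.2].
    by apply: prefP.1.1; exists B, C; split=> //; apply: UU'P.
  move=> [UB|UB] C CB.
    by have [D UD DC] := idU.1.2 B UB C CB; exists D => //; left.
  by have [D UD DC] := idU'.1.2 B UB C CB; exists D => //; right.
by rewrite -(maxU _ idUU' (@subsetUl _ _ _)) (maxU' _ idUU' (@subsetUr _ _ _)).
Qed.

Hypothesis AF : is_AF G.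

(** In an AF a direct defeat hits an argument, its own owner, while an indirect defeat of an attack
    is by definition a hit on its source. *)
Lemma AF_defeatsP V W : elements G W ->
  defeats G V W <->
  exists2 D, V = Att (D, Arg (owner W)) & D_attacks G D (owner W).
Proof.
move=> GW; split.
  move=> [[D X] [Galpha -> [|[beta [Gbeta -> ind]]]]]; last first.
    by move: Galpha; rewrite /D_attacks /= (ind : _ = X); exists D.
  rewrite /directly_defeats /= => WX; subst X; exists D; last first.
    by have [B /= WB] := AF Galpha; rewrite WB /= /D_attacks -WB.
  by have [B /= ->] := AF Galpha.
move=> [D -> DW]; exists (D, Arg (owner W)); split=> //.
case: GW DW => [[a _ <-]|[beta Gbeta <-]] DW; first by left.
by right; exists beta.
Qed.

Lemma D_admissible_owner S : admissible G S -> D_admissible G (@owner A @` S).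
Proof.
move=> [SG cfS accS].
(* The defender in [S] defeats the attack [(C, Arg (owner V))], whose owner is [C]; hence it is an
   attack aimed at [C]. *)
have defended C V : S V -> D_attacks G C (owner V) ->
    exists D, S (Att (D, Arg C)) /\ D_attacks G D C.
  move=> SV CV.
  have [|W SW /AF_defeatsP[|D DW DC]] := accS V SV (C, Arg (owner V)) CV.
  - by apply/AF_defeatsP; [exact: SG | exists C].
  - by right; exists (C, Arg (owner V)).
  - by exists D; split=> //; rewrite -DW.
split=> [[_ [_ [[V SV <-] [W SW <-] VW]]] | _ [V SV <-] C CV].
  (* The attack from [owner V] on [owner W] need not lie in [S]. But [S] defends [W] by an attack
     aimed at [owner V], and that attack defeats [V] inside [S]. *)
  have [D [SD DV]] := defended _ _ SW VW.
  apply: cfS; exists (Att (D, Arg (owner V))), V; split=> //.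
  by apply/AF_defeatsP; [exact: SG | exists D].
have [D [SD DC]] := defended _ _ SV CV.
by exists D => //; exists (Att (D, Arg C)).
Qed.

Lemma admissible_to_AFRA U : D_admissible G U -> admissible G (to_AFRA G U).
Proof.
move=> [cfU accU]; split=> [V /to_AFRAP[] // | | W /to_AFRAP[GW UW]].
  move=> [V [W [/to_AFRAP[_ UV] /to_AFRAP[GW UW] /(AF_defeatsP _ GW)[D VD DW]]]].
  by apply: cfU; exists D, (owner W); split=> //; rewrite VD in UV.
move=> alpha Galpha /(AF_defeatsP _ GW)[C [alphaC] CW].
(* The attack of [D] on [C] belongs to [to_AFRA G U] because its source is in [U], and it defeats
   [alpha] indirectly, through the source [C] of [alpha]. *)
have [D UD DC] := accU _ UW _ CW.
have GD : elements G (Att (D, Arg C)) by right; exists (D, Arg C).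
exists (Att (D, Arg C)); first exact/to_AFRAP.
by apply/AF_defeatsP; [right; exists alpha | exists D; rewrite /= alphaC].
Qed.

Let owner_mono := @image_subset _ _ (@owner A).

Let admissible_extensive S : admissible G S -> S `<=` to_AFRA G (@owner A @` S).
Proof. by move=> [SG _ _]; exact: sub_to_AFRA_owner. Qed.

Lemma D_preferred_owner P :
  preferred_extension G P -> D_preferred_extension G (@owner A @` P).
Proof.
exact: (maximal_for_lower to_AFRA_mono owner_to_AFRA admissible_extensive
  D_admissible_owner admissible_to_AFRA).
Qed.

Lemma preferred_to_AFRA Q :
  D_preferred_extension G Q -> preferred_extension G (to_AFRA G Q).
Proof.
exact: (maximal_for_upper owner_mono owner_to_AFRA admissible_extensive
  D_admissible_owner admissible_to_AFRA).
Qed.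

Lemma preferred_closed P :
  preferred_extension G P -> to_AFRA G (@owner A @` P) = P.
Proof.
exact: (maximal_for_closed admissible_extensive D_admissible_owner
  admissible_to_AFRA).
Qed.

(** Each D-preferred [Q] is the owner image of a preferred extension, namely [to_AFRA G Q], which
    contains [S]. *)
Lemma D_ideal_owner S : ideal G S -> D_ideal G (@owner A @` S).
Proof.
move=> [admS subS]; split=> [|Q prefQ]; first exact: D_admissible_owner.
rewrite -[Q]owner_to_AFRA; apply: owner_mono.
exact: subS (preferred_to_AFRA prefQ).
Qed.

(** Each preferred [P] is recovered by [to_AFRA] from its owner image, a D-preferred set containing
    [U]. *)
Lemma ideal_to_AFRA U : D_ideal G U -> ideal G (to_AFRA G U).
Proof.
move=> [admU subU]; split=> [|P prefP]; first exact: admissible_to_AFRA.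
rewrite -(preferred_closed prefP); apply: to_AFRA_mono.
exact: subU (D_preferred_owner prefP).
Qed.

Lemma ideal_extensive S : ideal G S -> S `<=` to_AFRA G (@owner A @` S).
Proof. by move=> [admS _]; exact: admissible_extensive. Qed.

End Correspondence.

Theorem proposition11 (A : Type) (G : AFRA A) (S : set (object A)) :
  is_AF G ->
  ideal_extension G S ->
  exists U : set A, unique (D_ideal_extension G) U /\ S = to_AFRA G U.
Proof.
move=> AF idS.
have idU : D_ideal_extension G (@owner A @` S).
  exact: (maximal_for_lower (@to_AFRA_mono _ G) (@owner_to_AFRA _ G)
    (@ideal_extensive _ G) (D_ideal_owner AF) (ideal_to_AFRA AF) idS).
exists (@owner A @` S); split.
  by split=> // U' idU'; exact: D_ideal_extension_unique idU idU'.
by rewrite (maximal_for_closed (@ideal_extensive _ G) (D_ideal_owner AF)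
  (ideal_to_AFRA AF) idS).
Qed.
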